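(* Let $\mathcal{E}$ be a subset in $\mathbb{F}_q^2$ with $|\mathcal{E}|\gg q^{4/3}$. There exists a distinct distance subset $U\subseteq\mathcal{E}$ satisfying $$q^{1/3}\ll |U|\ll q^{1/2}.$$
   Context: $\mathbb{F}_q$ is the finite field of order $q$, where $q=p^r$ for some prime $p$ and positive integer $r$. The notation $X\ll Y$ (equivalently $Y\gg X$) means that there exists a constant $C>0$ such that $X\le CY$, where $X,Y$ are viewed as functions in $q$. For $\mathbf{x}=(x_1,x_2)\in\mathbb{F}_q^2$ write $||\mathbf{x}||=x_1^2+x_2^2\in\mathbb{F}_q$. A subset $U\subseteq\mathcal{E}$ is called a distinct distance subset if there are no four distinct points $\mathbf{x},\mathbf{y},\mathbf{z},\mathbf{t}\in U$ such that $||\mathbf{x}-\mathbf{y}||=||\mathbf{z}-\mathbf{t}||$.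
   Formalization: The field order q is assumed odd: for even q the claim fails, since ||x-y|| = (s(x)-s(y))^2 with s(x) = x_1+x_2, and E = {x : s(x) in A}, A an additive subgroup of size about q^{1/3}, has only distinct distance subsets of size O(q^{1/6}). *)

(* Defs.v *)
From HB Require Import structures.
From mathcomp Require Import all_boot all_order all_algebra.

Set Implicit Arguments.
Unset Strict Implicit.
Unset Printing Implicit Defensive.

Import GRing.Theory.
Local Open Scope ring_scope.

Definition dnorm (F : finFieldType) (x : 'rV[F]_2) : F :=
  x 0 0 ^+ 2 + x 0 1 ^+ 2.

(* The four points must be pairwise distinct: coincidences such as
   dnorm (x - y) = dnorm (x - z) are allowed. *)
Definition distinct_distance (F : finFieldType) (U : {set 'rV[F]_2}) : Prop :=
  ~ exists x y z t : 'rV[F]_2,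
      [/\ [/\ x \in U, y \in U, z \in U & t \in U],
          uniq [:: x; y; z; t]
        & dnorm (x - y) = dnorm (z - t)].

(* Main.v *)
Require Import Defs.
From HB Require Import structures.
From mathcomp Require Import all_boot all_order all_algebra.
From mathcomp Require Import all_fingroup all_solvable all_field all_character.
From mathcomp Require Import reals exp.
From mathcomp Require Import ring lra zify.

Set Implicit Arguments.
Unset Strict Implicit.
Unset Printing Implicit Defensive.

Import Order.TTheory GRing.Theory Num.Theory.
Local Open Scope ring_scope.

(** Write N = |E|, let f be the Fourier transform of the indicator of E, and for
    each r let nu(r) be the number of pairs of E at distance r and sigma(r) the
    mass of |f|^2 on the circle ||xi|| = r.  Gauss sums express the additive
    transform of nu through that of sigma, so Parseval on F_q yields
    q^2 sum_r nu(r)^2 = q N^4 - q^3 N^2 + sum_r sigma(r)^2.  The terms r = 0 may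
    both be too large (E may be a union of isotropic lines) but they cancel up
    to N^4.  For r <> 0 the circle of radius r has only trivial additive
    quadruples, which gives sigma(r)^2 <= 3 q^2 N^3 by duality and an L^4
    estimate.  Hence the number of quadruples of E with equal nonzero distance
    is O(N^4 / q) once N >= C q^(4/3).

    A random subset of E of size about c q^(1/3) therefore contains few such
    quadruples, and also few pairs at distance zero, of which there are at most
    2 q N.  Deleting a point from each leaves a distinct distance subset, and
    any subset of it is again one, so that the upper bound comes from
    truncation. *)

(** * Additive characters of a finite field *)

Definition nontrivial_character (F : finFieldType) (psi : F -> algC) : Prop :=
  [/\ forall a b, psi (a + b) = psi a * psi b, psi 0 = 1,
      forall a, psi (- a) = (psi a)^* & \sum_a psi a = 0].

(** The irreducible characters of the additive group are linear and number [#|F| > 1]; a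
    nonprincipal one is orthogonal to the principal one, whence the vanishing sum. *)
Lemma exists_nontrivial_character (F : finFieldType) :
  exists psi : F -> algC, nontrivial_character psi.
Proof.
pose G : {group F} := [set: F]%G.
have abG : abelian G by apply/centsP => x _ y _; exact: addrC.
have linG := char_abelianP G abG.
have NG : Nirr G = #|F|.
  by rewrite NirrE; apply/eqP; rewrite -cardsT -card_classes_abelian.
have F1 : (1 < Nirr G)%N by rewrite NG; exact: finNzRing_gt1.
pose i : Iirr G := Ordinal F1.
exists (fun a : F => 'chi_i a); split.
- by move=> a b; rewrite -(lin_charM (linG i)) ?inE.
- exact: (lin_char1 (linG i)).
- by move=> a; rewrite -(lin_charV_conj (linG i)) ?inE.
- have := cfdot_irr i (0 : Iirr G); rewrite -val_eqE /= cfdotE.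
  move/eqP; rewrite mulf_eq0 invr_eq0 pnatr_eq0 eqn0Ngt cardG_gt0 /=.
  move=> /eqP sum0.
  rewrite -[RHS]sum0; apply: eq_big => [a|a _]; first by rewrite inE.
  by rewrite irr0 cfun1E inE conjC1 mulr1.
Qed.

(** * Geometry of the plane over a finite field *)

Definition vec2 (F : finFieldType) (a b : F) : 'rV[F]_2 :=
  \row_j (if j == 0 then a else b).

Definition dot (F : finFieldType) (x y : 'rV[F]_2) : F :=
  x 0 0 * y 0 0 + x 0 1 * y 0 1.

Section Plane.

Variable F : finFieldType.
Implicit Types (a b c s t : F) (u v w x y z xi eta : 'rV[F]_2).

Lemma vec2_0 a b : vec2 a b 0 0 = a. Proof. by rewrite mxE eqxx. Qed.

Lemma vec2_1 a b : vec2 a b 0 1 = b. Proof. by rewrite mxE. Qed.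

Lemma vec2_eqP u v : reflect (u 0 0 = v 0 0 /\ u 0 1 = v 0 1) (u == v).
Proof.
apply: (iffP eqP) => [-> // | [e0 e1]].
apply/rowP => j; have [->|->] // : j = 0 \/ j = 1.
by case: j => [[|[|]]] // ?; [left|right]; apply/val_inj.
Qed.

Lemma big_vec2 (S : nmodType) (f : 'rV[F]_2 -> S) :
  \sum_x f x = \sum_a \sum_b f (vec2 a b).
Proof.
rewrite pair_big /= (reindex (fun p : F * F => vec2 p.1 p.2)) //.
exists (fun x => (x 0 0, x 0 1)) => [[a b] | x] _ /=.
  by rewrite vec2_0 vec2_1.
by apply/eqP/vec2_eqP; rewrite vec2_0 vec2_1.
Qed.

Lemma dotC x y : dot x y = dot y x.
Proof. by rewrite /dot; ring. Qed.

Lemma dotDr x y z : dot z (x + y) = dot z x + dot z y.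
Proof. by rewrite /dot !mxE; ring. Qed.

Lemma dotNr x z : dot z (- x) = - dot z x.
Proof. by rewrite /dot !mxE; ring. Qed.

Lemma dotBr x y z : dot z (x - y) = dot z x - dot z y.
Proof. by rewrite dotDr dotNr. Qed.

Lemma dotNl x z : dot (- x) z = - dot x z.
Proof. by rewrite /dot !mxE; ring. Qed.

Lemma dotZr c x z : dot z (c *: x) = c * dot z x.
Proof. by rewrite /dot !mxE; ring. Qed.

Lemma dotZl c x z : dot (c *: x) z = c * dot x z.
Proof. by rewrite /dot !mxE; ring. Qed.

Lemma dnormE x : dnorm x = dot x x.
Proof. by rewrite /dnorm /dot; ring. Qed.

Lemma dnorm0 : dnorm 0 = 0 :> F.
Proof. by rewrite /dnorm !mxE; ring. Qed.

Lemma dnormN x : dnorm (- x) = dnorm x.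
Proof. by rewrite !dnormE dotNr dotNl opprK. Qed.

Lemma dnormD x y : dnorm (x + y) = dnorm x + dnorm y + dot x y *+ 2.
Proof. by rewrite /dnorm /dot !mxE; ring. Qed.

Lemma dnormZ c x : dnorm (c *: x) = c ^+ 2 * dnorm x.
Proof. by rewrite /dnorm !mxE; ring. Qed.

Lemma two_neq0 : odd #|F| -> (2%:R : F) != 0.
Proof.
move=> oddF; apply/eqP => two0.
have: (1 : F) *+ #|F| == 0.
  rewrite -cardsT -FinRing.zmodXgE -[_ == _]order_dvdn.
  by apply: (@order_dvdG F [set: F]%G); exact: in_setT.
rewrite -(odd_double_half #|F|) oddF -mul2n mulrnDr mulrnA two0 mul0rn addr0.
by rewrite oner_eq0.
Qed.

Definition cross x y : F := x 0 0 * y 0 1 - x 0 1 * y 0 0.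

Lemma lagrange_identity x y :
  dnorm x * dnorm y = dot x y ^+ 2 + cross x y ^+ 2.
Proof. by rewrite /dnorm /dot /cross; ring. Qed.

(** The two hypotheses form a linear system in [y] with determinant [dnorm x]. *)
Lemma dot_cross_eq0 x y :
  dot x y = 0 -> cross x y = 0 -> (dnorm x == 0) || (y == 0).
Proof.
move=> d0 c0; have [//|nx0 /=] := eqVneq (dnorm x) 0.
apply/vec2_eqP; rewrite !mxE; split; apply: (mulfI nx0); rewrite mulr0.
  transitivity (x 0 0 * dot x y - x 0 1 * cross x y).
    by rewrite /dnorm /dot /cross; ring.
  by rewrite d0 c0 !mulr0 subrr.
transitivity (x 0 1 * dot x y + x 0 0 * cross x y).
  by rewrite /dnorm /dot /cross; ring.
by rewrite d0 c0 !mulr0 addr0.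
Qed.

(** The kernel of the matrix with rows [x] and [y] contains [z], and [cross x y] is its
    determinant. *)
Lemma orthogonal_cross_eq0 x y z :
  z != 0 -> dot z x = 0 -> dot z y = 0 -> cross x y = 0.
Proof.
rewrite /dot /cross => z0 zx zy; apply/eqP; apply: contraNT z0 => c0.
apply/vec2_eqP; rewrite !mxE; split; apply: (mulIf c0); rewrite mul0r.
  transitivity ((z 0 0 * x 0 0 + z 0 1 * x 0 1) * y 0 1
              - (z 0 0 * y 0 0 + z 0 1 * y 0 1) * x 0 1); first by ring.
  by rewrite zx zy !mul0r subrr.
transitivity ((z 0 0 * y 0 0 + z 0 1 * y 0 1) * x 0 0
            - (z 0 0 * x 0 0 + z 0 1 * x 0 1) * y 0 0); first by ring.
by rewrite zx zy !mul0r subrr.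
Qed.

Lemma isotropic_orthogonal x y :
  x != 0 -> dnorm x = 0 -> dot x y = 0 -> dnorm y = 0.
Proof.
move=> x0 nx xy.
have : cross y x == 0.
  have := lagrange_identity y x; rewrite nx mulr0 [dot y x]dotC xy expr0n add0r.
  by move/esym/eqP; rewrite expf_eq0.
move/eqP => cyx; rewrite dotC in xy.
by have := dot_cross_eq0 xy cyx; rewrite (negbTE x0) orbF => /eqP.
Qed.

(* For another point eta of the intersection, d = eta - xi and
   s = eta + xi - w are orthogonal to each other and both orthogonal to w, hence
   parallel: either s = 0, or d, and with it w and xi, is isotropic. *)
Lemma circle_intersection r w : odd #|F| -> r != 0 -> w != 0 ->
  (#|[set xi | (dnorm xi == r) && (dnorm (w - xi) == r)]| <= 2)%N.
Proof.
move=> oddF r0 w0; set A := [set xi | _].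
have [->|[xi]] := set_0Vmem A; first by rewrite cards0.
have t0 := two_neq0 oddF.
have dotw eta : eta \in A -> dnorm eta = r /\ 2 * dot w eta = dnorm w.
  rewrite inE => /andP[/eqP etar /eqP wetar]; split=> //.
  apply/esym/eqP; rewrite -subr_eq0; apply/eqP.
  have := dnormD w (- eta); rewrite dnormN dotNr wetar etar => e.
  by apply: (addIr r); rewrite add0r [RHS]e mulr_natl mulNrn; ring.
move=> xiA; have [xir wxi] := dotw _ xiA.
suff /subset_leq_card /leq_trans : A \subset [set xi; w - xi].
  by apply; rewrite cards2; case: (_ != _).
apply/subsetP => eta /dotw[etar weta]; rewrite !inE.
have [//|dne /=] := eqVneq eta xi.
pose d := eta - xi; pose s := eta + xi - w.
have d0 : d != 0 by rewrite subr_eq0.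
have wd : dot w d = 0.
  by apply: (mulfI t0); rewrite dotBr mulrBr wxi weta subrr mulr0.
have ws : dot w s = 0.
  apply: (mulfI t0); rewrite dotBr dotDr mulrBr mulrDr wxi weta -dnormE.
  by ring.
have ds : dot d s = 0.
  rewrite dotBr [dot d w]dotC wd subr0.
  transitivity (dnorm eta - dnorm xi); last by rewrite xir etar subrr.
  by rewrite /d /dot /dnorm !mxE; ring.
have := dot_cross_eq0 ds (orthogonal_cross_eq0 w0 wd ws).
case/orP => [/eqP nd0|]; last first.
  by rewrite /s -addrA addr_eq0 opprB.
have nw0 : dnorm w = 0 by apply: (isotropic_orthogonal d0 nd0); rewrite dotC.
case/eqP: r0; rewrite -xir; apply: (isotropic_orthogonal w0 nw0).
by apply: (mulfI t0); rewrite wxi nw0 mulr0.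
Qed.

End Plane.

(** * Fourier transform and Gauss sums *)

Section Fourier.

Variables (F : finFieldType) (psi : F -> algC).
Hypothesis psiP : nontrivial_character psi.

Local Notation V := 'rV[F]_2.
Local Notation q := (#|F|%:R : algC).

Lemma charD a b : psi (a + b) = psi a * psi b. Proof. by case: psiP. Qed.

Lemma char0 : psi 0 = 1. Proof. by case: psiP. Qed.

Lemma charN a : psi (- a) = (psi a)^*. Proof. by case: psiP. Qed.

Lemma charB a b : psi (a - b) = psi a * (psi b)^*.
Proof. by rewrite charD charN. Qed.

Lemma sum_char a : \sum_s psi (s * a) = q *+ (a == 0).
Proof.
have [->|a0] := eqVneq a 0.
  rewrite (eq_bigr (fun=> 1)) ?sumr_const ?mulr1n //.
  by move=> s _; rewrite mulr0 char0.
have [_ _ _ sum0] := psiP.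
rewrite mulr0n -[RHS]sum0 [RHS](reindex (fun s => s * a)) //.
by exists (fun s => s / a) => s _; rewrite ?mulfK ?divfK.
Qed.

Lemma sum_char_dot (u : V) : \sum_xi psi (dot xi u) = q ^+ 2 *+ (u == 0).
Proof.
rewrite big_vec2.
have -> : \sum_a \sum_b psi (dot (vec2 a b) u)
    = (\sum_a psi (a * u 0 0)) * (\sum_b psi (b * u 0 1)).
  rewrite mulr_suml; apply: eq_bigr => a _; rewrite mulr_sumr.
  by apply: eq_bigr => b _; rewrite -charD /dot vec2_0 vec2_1.
rewrite !sum_char.
have -> : (u == 0) = (u 0 0 == 0) && (u 0 1 == 0).
  by apply/vec2_eqP/andP; rewrite mxE mxE => -[/eqP e0 /eqP e1].
by do 2![case: eqP => _]; rewrite ?mulr0n ?mulr0 ?mul0r // -expr2.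
Qed.

Lemma sum_char_dotl (u : V) : \sum_x psi (dot u x) = q ^+ 2 *+ (u == 0).
Proof. by rewrite -sum_char_dot; apply: eq_bigr => x _; rewrite dotC. Qed.

Definition ft (g : V -> algC) (xi : V) : algC := \sum_x g x * psi (dot xi x).

Lemma ft_mul_conj (g : V -> algC) xi :
  ft g xi * (ft g xi)^*
  = \sum_x \sum_y g x * (g y)^* * psi (dot xi (x - y)).
Proof.
rewrite /ft rmorph_sum /= mulr_suml; apply: eq_bigr => x _.
rewrite mulr_sumr; apply: eq_bigr => y _.
by rewrite dotBr charB rmorphM /= mulrACA.
Qed.

Lemma parseval (g : V -> algC) :
  \sum_xi ft g xi * (ft g xi)^* = q ^+ 2 * \sum_x g x * (g x)^*.
Proof.
under eq_bigr do rewrite ft_mul_conj.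
rewrite exchange_big mulr_sumr; apply: eq_bigr => x _ /=.
rewrite exchange_big (bigD1 x) //= [X in _ + X]big1 ?addr0 => [|y yx].
  by rewrite -mulr_sumr sum_char_dot subrr eqxx mulr1n mulrC.
by rewrite -mulr_sumr sum_char_dot subr_eq0 eq_sym (negbTE yx) mulr0.
Qed.

Lemma parseval1 (a : F -> algC) :
  \sum_c (\sum_r psi (c * r) * a r) * (\sum_r psi (c * r) * a r)^*
  = q * \sum_r a r * (a r)^*.
Proof.
have expand c : (\sum_r psi (c * r) * a r) * (\sum_r psi (c * r) * a r)^*
    = \sum_r \sum_t a r * (a t)^* * psi (c * (r - t)).
  rewrite rmorph_sum mulr_suml; apply: eq_bigr => r _.
  rewrite mulr_sumr; apply: eq_bigr => t _.
  by rewrite mulrBr charB rmorphM /= mulrACA mulrC.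
under eq_bigr do rewrite expand.
rewrite exchange_big mulr_sumr; apply: eq_bigr => r _ /=.
rewrite exchange_big (bigD1 r) //= [X in _ + X]big1 ?addr0 => [|t tr].
  by rewrite -mulr_sumr sum_char subrr eqxx mulr1n mulrC.
by rewrite -mulr_sumr sum_char subr_eq0 eq_sym (negbTE tr) mulr0.
Qed.

Lemma sum_char_expansion (a : F -> algC) :
  \sum_c \sum_r psi (c * r) * a r = q * a 0.
Proof.
rewrite exchange_big (bigD1 0) //= [X in _ + X]big1 ?addr0 => [|r r0].
  by rewrite -mulr_suml sum_char eqxx.
by rewrite -mulr_suml sum_char (negbTE r0) mul0r.
Qed.

End Fourier.

Section GaussSum.

Variables (F : finFieldType) (psi : F -> algC).
Hypothesis psiP : nontrivial_character psi.
Hypothesis oddF : odd #|F|.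

Local Notation V := 'rV[F]_2.
Local Notation q := (#|F|%:R : algC).

(** Pigeonhole: as [#|F|] is odd, more than half of the elements are squares, so the squares meet
    the set of all [c - t ^+ 2]. *)
Lemma sum_two_squares (c : F) : exists s t : F, s ^+ 2 + t ^+ 2 = c.
Proof.
pose A := [set s ^+ 2 | s : F]; pose B : {set F} := [set c - t ^+ 2 | t : F].
have cardA : (#|F| <= 2 * #|A|)%N.
  rewrite -[leqLHS]sum1_card.
  rewrite (partition_big (fun s => s ^+ 2) (mem A)) /=; last first.
    by move=> s _; apply: imset_f.
  rewrite [leqRHS]mulnC -sum_nat_const; apply: leq_sum => a /imsetP[s _ ->].
  rewrite sum1dep_card (_ : [set _ | _] = [set s; - s]); last first.
    by apply/setP => x; rewrite !inE eqf_sqr.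
  by rewrite cards2; case: (_ != _).
have cardB : #|B| = #|A|.
  rewrite -(card_imset A (f := fun a => c - a)); last first.
    by move=> a b /addrI /oppr_inj.
  by rewrite -imset_comp.
have : A :&: B != set0.
  apply/negP => /eqP AB0; have := cardsUI A B; rewrite AB0 cards0 addn0 cardB.
  have cardU : (#|A :|: B| <= #|F|)%N := max_card _.
  by move: oddF cardA; lia.
case/set0Pn => a /setIP[/imsetP[s _ ->]] /imsetP[t _ st].
by exists s, t; rewrite st subrK.
Qed.

(** The square of the classical one-variable quadratic Gauss sum. *)
Definition gauss (c : F) : algC := \sum_(xi : V) psi (c * dnorm xi).

(* Multiplication by a "complex number" s + t i of norm c maps the circle of
   radius r onto that of radius c r. *)
Lemma gauss_const (c : F) : c != 0 -> gauss c = gauss 1.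
Proof.
have [s [t st]] := sum_two_squares c; move=> c0.
pose m (x : V) := vec2 (s * x 0 0 - t * x 0 1) (s * x 0 1 + t * x 0 0).
have minj : injective m.
  move=> x y mxy.
  have e0 : m x 0 0 = m y 0 0 by rewrite mxy.
  have e1 : m x 0 1 = m y 0 1 by rewrite mxy.
  rewrite /m !vec2_0 in e0; rewrite /m !vec2_1 in e1.
  apply/eqP/vec2_eqP; split; apply: (mulfI c0); rewrite -st.
    transitivity (s * (s * x 0 0 - t * x 0 1) + t * (s * x 0 1 + t * x 0 0)).
      by ring.
    by rewrite e0 e1; ring.
  transitivity (s * (s * x 0 1 + t * x 0 0) - t * (s * x 0 0 - t * x 0 1)).
    by ring.
  by rewrite e0 e1; ring.
rewrite /gauss [RHS](reindex_inj minj); apply: eq_bigr => x _.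
by rewrite mul1r -st /dnorm vec2_0 vec2_1; congr psi; ring.
Qed.

(** After the shift [xi = x + h] the sum over [x] is a character sum of frequency [(2 * c) *: h], so
    only [h = 0] survives. *)
Lemma gauss_mul_conj (c : F) : c != 0 -> gauss c * (gauss c)^* = q ^+ 2.
Proof.
move=> c0; rewrite /gauss rmorph_sum /= mulr_sumr.
have shift (x : V) :
    (\sum_(xi : V) psi (c * dnorm xi)) * (psi (c * dnorm x))^*
    = \sum_(h : V) psi (c * dnorm h) * psi (dot ((2 * c) *: h) x).
  rewrite mulr_suml (reindex_inj (addIr x)) /=; apply: eq_bigr => h _.
  rewrite -(charB psiP) -(charD psiP); congr psi.
  by rewrite dnormD dotZl -mulr_natl; ring.
rewrite (eq_bigr _ (fun x _ => shift x)).
rewrite exchange_big (bigD1 0) //= [X in _ + X]big1 ?addr0 => [|h h0].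
  rewrite -mulr_sumr (sum_char_dotl psiP) scaler0 eqxx.
  by rewrite dnorm0 mulr0 (char0 psiP) mul1r mulr1n.
rewrite -mulr_sumr (sum_char_dotl psiP) scaler_eq0 (negbTE h0) orbF mulf_eq0.
by rewrite (negbTE c0) (negbTE (two_neq0 oddF)) mulr0.
Qed.

(** Conjugation turns [gauss 1] into [gauss (- 1)], which equals it by [gauss_const]; so it is real,
    of modulus [q]. *)
Lemma gauss_eq : gauss 1 = q \/ gauss 1 = - q.
Proof.
have := gauss_mul_conj (oner_neq0 F).
have -> : (gauss 1)^* = gauss 1.
  rewrite -[RHS](@gauss_const (- 1)) ?oppr_eq0 ?oner_eq0 //.
  rewrite /gauss rmorph_sum /=.
  by apply: eq_bigr => x _; rewrite -(charN psiP) mulNr.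
by move/eqP; rewrite -expr2 eqf_sqr => /orP[] /eqP; [left|right].
Qed.

(** Completing the square: [xi] is translated by [(2 * c)^-1 *: u]. *)
Lemma gauss_phase (c : F) (u : V) : c != 0 ->
  \sum_xi psi (c * dnorm xi) * psi (dot xi u)
  = gauss 1 * psi (- (4 * c)^-1 * dnorm u).
Proof.
move=> c0; rewrite -(gauss_const c0) mulr_suml.
rewrite [RHS](reindex_inj (addIr ((2 * c)^-1 *: u))) /=.
have t0 := two_neq0 oddF.
apply: eq_bigr => xi _; rewrite -!(charD psiP); congr psi.
rewrite dnormD dnormZ dotZr; field.
rewrite c0 t0 /= -[4]/(2 * 2)%:R natrM mulf_neq0 //.
Qed.

End GaussSum.

Lemma sum_cauchy_schwarz (I : finType) (A : {set I}) (a : I -> algC) :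
  (\sum_(i in A) a i) * (\sum_(i in A) a i)^*
  <= #|A|%:R * \sum_(i in A) a i * (a i)^*.
Proof.
set s := \sum_(i in A) a i; set n := \sum_(i in A) a i * (a i)^*.
have : 0 <= \sum_(i in A) \sum_(j in A) (a i - a j) * (a i - a j)^*.
  by do 2!apply: sumr_ge0 => ? _; exact: mul_conjC_ge0.
have -> : \sum_(i in A) \sum_(j in A) (a i - a j) * (a i - a j)^*
    = 2 * (#|A|%:R * n - s * s^*).
  have inner i : \sum_(j in A) (a i - a j) * (a i - a j)^*
      = #|A|%:R * (a i * (a i)^*) + n - a i * s^* - s * (a i)^*.
    rewrite rmorph_sum /= mulr_sumr mulr_suml -!sumrN mulr_natl -sumr_const.
    by rewrite -!big_split; apply: eq_bigr => j _ /=; rewrite rmorphB /=; ring.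
  rewrite (eq_bigr _ (fun i _ => inner i)) !sumrB big_split /= -mulr_sumr.
  rewrite sumr_const -mulr_suml -mulr_sumr -rmorph_sum -[n *+ _]mulr_natl.
  by rewrite /= -/n -/s; ring.
by rewrite pmulr_rge0 ?ltr0n // subr_ge0.
Qed.

(** * The distance energy *)

Section Energy.

Variables (F : finFieldType) (psi : F -> algC).
Hypothesis psiP : nontrivial_character psi.
Hypothesis oddF : odd #|F|.

Local Notation V := 'rV[F]_2.
Local Notation q := (#|F|%:R : algC).

(** Frequency [c = 0] is split off because the duality between [sigma] and [nu] holds for
    [c != 0]. *)
Lemma sum_nonzero_expansion (a : F -> algC) :
  \sum_(c | c != 0) \sum_r psi (c * r) * a r = q * a 0 - \sum_r a r.
Proof.
rewrite -(sum_char_expansion psiP a) [X in _ = X - _](bigD1 0) //=.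
have -> : \sum_r psi (0 * r) * a r = \sum_r a r.
  by apply: eq_bigr => r _; rewrite mul0r (char0 psiP) mul1r.
by rewrite addrAC subrr add0r.
Qed.

Lemma parseval1_nonzero (a : F -> algC) :
  \sum_(c | c != 0)
    (\sum_r psi (c * r) * a r) * (\sum_r psi (c * r) * a r)^*
  = q * (\sum_r a r * (a r)^*) - (\sum_r a r) * (\sum_r a r)^*.
Proof.
rewrite -(parseval1 psiP a) [X in _ = X - _](bigD1 0) //=.
have -> : \sum_r psi (0 * r) * a r = \sum_r a r.
  by apply: eq_bigr => r _; rewrite mul0r (char0 psiP) mul1r.
by rewrite addrAC subrr add0r.
Qed.

Lemma sum_ft_mul_conj_le (g : V -> algC) (E : {set V}) :
  \sum_(x in E) ft psi g x * (ft psi g x)^*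
  <= \sum_x ft psi g x * (ft psi g x)^*.
Proof.
rewrite [leRHS](bigID (mem E)) /= lerDl.
by apply: sumr_ge0 => x _; exact: mul_conjC_ge0.
Qed.

Definition convolution (g : V -> algC) (w : V) : algC :=
  \sum_xi g xi * g (w - xi).

Lemma ft_conv (g : V -> algC) x : ft psi (convolution g) x = ft psi g x ^+ 2.
Proof.
rewrite /ft /convolution expr2 mulr_suml.
under eq_bigr do rewrite mulr_suml.
rewrite exchange_big; apply: eq_bigr => xi _ /=.
rewrite (reindex_inj (addrI xi)) mulr_sumr; apply: eq_bigr => w _ /=.
by rewrite addrAC subrr add0r dotDr (charD psiP) mulrACA.
Qed.

Variable E : {set V}.
Local Notation N := (#|E|%:R : algC).

Definition indicator (x : V) : algC := (x \in E)%:R.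

Lemma ft_ind xi : ft psi indicator xi = \sum_(x in E) psi (dot xi x).
Proof.
rewrite [RHS]big_mkcond /=; apply: eq_bigr => x _; rewrite /indicator.
by case: (x \in E); rewrite ?mul1r ?mul0r.
Qed.

Lemma ft_indN xi : ft psi indicator (- xi) = (ft psi indicator xi)^*.
Proof.
rewrite !ft_ind rmorph_sum /=; apply: eq_bigr => x _.
by rewrite dotNl (charN psiP).
Qed.

Definition power xi := ft psi indicator xi * (ft psi indicator xi)^*.

Lemma power_ge0 xi : 0 <= power xi. Proof. exact: mul_conjC_ge0. Qed.

Lemma powerE xi : power xi = \sum_(p in setX E E) psi (dot xi (p.1 - p.2)).
Proof.
rewrite /power ft_ind rmorph_sum /= mulr_suml.
under [LHS]eq_bigr do rewrite mulr_sumr.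
rewrite pair_big; apply: eq_big => [[x y]|p _] /=; first by rewrite in_setX.
by rewrite dotBr (charB psiP).
Qed.

Definition sigma r := \sum_(xi | dnorm xi == r) power xi.

Definition nu (r : F) : nat := #|[set p in setX E E | dnorm (p.1 - p.2) == r]|.

Lemma sigma_ge0 r : 0 <= sigma r.
Proof. by apply: sumr_ge0 => xi _; exact: power_ge0. Qed.

Lemma sum_power : \sum_xi power xi = q ^+ 2 * N.
Proof.
rewrite parseval //; congr (_ * _).
rewrite -sumr_const [RHS]big_mkcond /=; apply: eq_bigr => x _.
by rewrite /indicator; case: (x \in E); rewrite ?rmorph1 ?mul1r ?mul0r.
Qed.

Lemma sum_sigma : \sum_r sigma r = q ^+ 2 * N.
Proof. by rewrite -sum_power (partition_big (@dnorm F) predT). Qed.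

Lemma sum_psi_sigma c :
  \sum_r psi (c * r) * sigma r = \sum_xi psi (c * dnorm xi) * power xi.
Proof.
rewrite [RHS](partition_big (@dnorm F) predT) //=; apply: eq_bigr => r _.
by rewrite mulr_sumr; apply: eq_bigr => xi /eqP ->.
Qed.

Lemma sum_psi_nu s :
  \sum_r psi (s * r) * (nu r)%:R
  = \sum_(p in setX E E) psi (s * dnorm (p.1 - p.2)).
Proof.
rewrite [RHS](partition_big (fun p => dnorm (p.1 - p.2)) predT) //=.
apply: eq_bigr => r _; rewrite mulr_natr -sumr_const.
by apply: eq_big => [p|p]; rewrite !inE // => /andP[_ /eqP ->].
Qed.

Lemma sum_nu : \sum_r (nu r)%:R = N ^+ 2.
Proof.
have := sum_psi_nu 0.
under eq_bigr do rewrite mul0r (char0 psiP) mul1r.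
under [RHS]eq_bigr do rewrite mul0r (char0 psiP).
by rewrite sumr_const cardsX natrM => ->.
Qed.

(** Applied to each difference of two points of [E], [gauss_phase] trades the norm of the frequency
    for that of the difference. *)
Lemma sigma_nu_duality c : c != 0 ->
  \sum_r psi (c * r) * sigma r
  = gauss psi 1 * \sum_r psi (- (4 * c)^-1 * r) * (nu r)%:R.
Proof.
move=> c0; rewrite sum_psi_sigma sum_psi_nu mulr_sumr.
under eq_bigr do rewrite powerE mulr_sumr.
by rewrite exchange_big; apply: eq_bigr => p _; rewrite /= gauss_phase.
Qed.

Lemma reindex_inv4 (f : F -> algC) :
  \sum_(c | c != 0) f (- (4 * c)^-1) = \sum_(c | c != 0) f c.
Proof.
have t0 := two_neq0 oddF.
have f0 : (4 : F) != 0 by rewrite -[4]/(2 * 2)%:R natrM mulf_neq0.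
have hK : involutive (fun c : F => - (4 * c)^-1).
  by move=> c /=; rewrite mulrN invrN opprK invfM invrK mulKf.
rewrite [RHS](reindex_inj (inv_inj hK)); apply: eq_bigl => c.
by rewrite oppr_eq0 invr_eq0 mulf_eq0 (negbTE f0).
Qed.

(** Summing the duality over [c != 0] isolates [r = 0] on both sides, since [- (4 * c)^-1] also runs
    over the nonzero elements. *)
Lemma nu0_eq :
  q * sigma 0 - q ^+ 2 * N = gauss psi 1 * (q * (nu 0)%:R - N ^+ 2).
Proof.
rewrite -sum_sigma -sum_nu -!sum_nonzero_expansion.
rewrite -[X in _ = _ * X]reindex_inv4 mulr_sumr.
by apply: eq_bigr => c c0; rewrite sigma_nu_duality.
Qed.

Lemma sigma_real r : (sigma r)^* = sigma r.
Proof. exact/CrealP/ger0_real/sigma_ge0. Qed.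

(** Parseval on [F] for both sides of the duality; the Gauss sum enters only through its squared
    modulus [q ^+ 2]. *)
Lemma energy_eq :
  q * \sum_r sigma r ^+ 2 - (q ^+ 2 * N) ^+ 2
  = q ^+ 2 * (q * (\sum_r nu r ^ 2)%:R - N ^+ 4).
Proof.
transitivity (\sum_(c | c != 0) (\sum_r psi (c * r) * sigma r)
                               * (\sum_r psi (c * r) * sigma r)^*).
  rewrite parseval1_nonzero sum_sigma rmorphM rmorphXn /= !rmorph_nat -expr2.
  by congr (q * _ - _); apply: eq_bigr => r _; rewrite sigma_real expr2.
have -> : q * (\sum_r nu r ^ 2)%:R - N ^+ 4
    = \sum_(c | c != 0) (\sum_r psi (c * r) * (nu r)%:R)
                      * (\sum_r psi (c * r) * (nu r)%:R)^*.
  rewrite parseval1_nonzero sum_nu rmorphXn /= rmorph_nat -exprD.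
  congr (q * _ - _); rewrite natr_sum; apply: eq_bigr => r _.
  by rewrite rmorph_nat -natrM.
rewrite -[X in _ = _ * X]reindex_inv4 mulr_sumr; apply: eq_bigr => c c0.
rewrite sigma_nu_duality // rmorphM /= mulrACA gauss_mul_conj ?oner_neq0 //.
Qed.

(* Duality and L^4: with g the conjugate of the transform of E restricted to the
   circle, sigma r is the sum over E of the transform of g, whose fourth moment
   is q^2 times the squared L^2 norm of the self-convolution of g. *)
Lemma sigma_sqr_le r : r != 0 -> sigma r ^+ 2 <= 3 * q ^+ 2 * N ^+ 3.
Proof.
move=> r0.
pose g xi := if dnorm xi == r then (ft psi indicator xi)^* else 0.
pose p xi := g xi * (g xi)^*.
have p_ge0 xi : 0 <= p xi by exact: mul_conjC_ge0.
have gN xi : g (- xi) = (g xi)^*.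
  by rewrite /g dnormN; case: ifP => _; rewrite ?ft_indN // rmorph0.
have sum_p : \sum_xi p xi = sigma r.
  rewrite /sigma [RHS]big_mkcond /=; apply: eq_bigr => xi _; rewrite /p /g.
  by case: ifP => _; rewrite ?mul0r // conjCK mulrC.
have sigmaE : sigma r = \sum_(x in E) ft psi g x.
  rewrite -sum_p.
  have -> : \sum_xi p xi = \sum_xi g xi * ft psi indicator xi.
    apply: eq_bigr => xi _; rewrite /p /g.
    by case: ifP => _; rewrite ?mul0r // conjCK.
  under eq_bigr do rewrite ft_ind mulr_sumr.
  rewrite exchange_big /=; apply: eq_bigr => x _.
  by apply: eq_bigr => xi _; rewrite dotC.
have conv0 : convolution g 0 = sigma r.
  by rewrite -sum_p; apply: eq_bigr => xi _; rewrite sub0r gN.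
have conv_le w : w != 0 ->
    convolution g w * (convolution g w)^* <= 2 * \sum_xi p xi * p (w - xi).
  (* Only [xi] in [A] contribute, at most two by [circle_intersection], so Cauchy-Schwarz costs a
     factor 2. *)
  move=> w0; pose A := [set xi | (dnorm xi == r) && (dnorm (w - xi) == r)].
  have -> : convolution g w = \sum_(xi in A) g xi * g (w - xi).
    rewrite [RHS]big_mkcond /=; apply: eq_bigr => xi _; rewrite inE /g.
    by do 2![case: ifP => _ //=]; rewrite ?mul0r ?mulr0.
  apply: le_trans (sum_cauchy_schwarz _ _) _.
  apply: ler_pM; rewrite ?ler0n ?ler_nat ?circle_intersection //.
    by apply: sumr_ge0 => xi _; exact: mul_conjC_ge0.
  rewrite [leRHS](bigID (mem A)) /=; apply: ler_wpDr.
    by apply: sumr_ge0 => xi _; exact: mulr_ge0.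
  by apply: ler_sum => xi _; rewrite rmorphM /= mulrACA.
have sum_conv : \sum_w convolution g w * (convolution g w)^*
    <= 3 * sigma r ^+ 2.
  (* The term [w = 0] gives [sigma r ^+ 2] and all others together at most twice that, hence the
     3. *)
  rewrite (bigD1 0) //= conv0 sigma_real -expr2.
  rewrite -[3]/((1 + 2)%:R) natrD mulrDl mul1r lerD2l.
  apply: le_trans (ler_sum _ conv_le) _; rewrite -mulr_sumr ler_pM2l ?ltr0n //.
  have -> : sigma r ^+ 2 = \sum_w \sum_xi p xi * p (w - xi).
    rewrite exchange_big expr2 -{1}sum_p mulr_suml; apply: eq_bigr => xi _.
    rewrite -mulr_sumr; congr (_ * _); rewrite -sum_p.
    by rewrite (reindex_inj (addIr (- xi))).
  rewrite [leRHS](bigD1 0) //= lerDr.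
  by apply: sumr_ge0 => xi _; exact: mulr_ge0.
have N0 : 0 <= N by exact: ler0n.
pose T := \sum_(x in E) ft psi g x * (ft psi g x)^*.
have T0 : 0 <= T by apply: sumr_ge0 => x _; exact: mul_conjC_ge0.
have sT : sigma r ^+ 2 <= N * T.
  have := sum_cauchy_schwarz E (ft psi g).
  by rewrite -sigmaE sigma_real -expr2.
(* The squared terms are fourth powers of the modulus of [ft psi g], that is, squared moduli of the
   transform of the convolution; the sum over [E] is enlarged to the plane for Parseval. *)
have TQ : T ^+ 2 <= N * (q ^+ 2 * (3 * sigma r ^+ 2)).
  have := sum_cauchy_schwarz E (fun x => ft psi g x * (ft psi g x)^*).
  rewrite -/T (CrealP (ger0_real T0)) -expr2 => /le_trans; apply.
  rewrite ler_wpM2l //.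
  have sum_conv_q : q ^+ 2 * (\sum_w convolution g w * (convolution g w)^*)
      <= q ^+ 2 * (3 * sigma r ^+ 2) by rewrite ler_wpM2l ?exprn_ge0 ?ler0n.
  apply: le_trans sum_conv_q.
  rewrite -(parseval psiP (convolution g)).
  apply: le_trans (sum_ft_mul_conj_le (convolution g) E).
  apply: ler_sum => x _; rewrite ft_conv rmorphM rmorphXn /= conjCK.
  by rewrite le_eqVlt; apply/orP; left; apply/eqP; ring.
(* Together, [sigma r ^+ 4] is at most [N ^+ 2 * T ^+ 2], hence at most
   [3 * q ^+ 2 * N ^+ 3 * sigma r ^+ 2]; a nonzero [sigma r ^+ 2] cancels. *)
have [->|s0] := eqVneq (sigma r) 0.
  by rewrite expr0n !mulr_ge0 ?exprn_ge0 ?ler0n.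
have s2_gt0 : 0 < sigma r ^+ 2 by rewrite exprn_gt0 // lt_def s0 sigma_ge0.
rewrite -(ler_pM2l s2_gt0) -expr2.
have /le_trans : (sigma r ^+ 2) ^+ 2 <= (N * T) ^+ 2.
  rewrite ler_pXn2r //; last by rewrite nnegrE mulr_ge0.
  by rewrite nnegrE ltW.
apply.
rewrite exprMn; apply: le_trans (ler_wpM2l (exprn_ge0 2 N0) TQ) _.
by rewrite le_eqVlt; apply/orP; left; apply/eqP; ring.
Qed.

End Energy.

(* The subtraction in the conclusion is truncated.  The point is that
   [s i0 ^+ 2], which can be as large as [(q * n i0) ^ 2] and is not under
   control, exceeds it by at most [N ^ 4]. *)
Lemma energy_arithmetic (K : realFieldType) (I : finType) (i0 : I)
    (s : I -> K) (n : I -> nat) (q N : nat) (e : K) :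
  (0 < q <= N)%N -> (N <= n i0)%N -> (forall i, 0 <= s i) ->
  \sum_i s i = q%:R ^+ 2 * N%:R ->
  (forall i, i != i0 -> s i ^+ 2 <= 3 * q%:R ^+ 2 * N%:R ^+ 3) ->
  e = q%:R \/ e = - q%:R ->
  q%:R * s i0 - q%:R ^+ 2 * N%:R = e * (q%:R * (n i0)%:R - N%:R ^+ 2) ->
  q%:R * (\sum_i s i ^+ 2) - (q%:R ^+ 2 * N%:R) ^+ 2
    = q%:R ^+ 2 * (q%:R * (\sum_i n i ^ 2)%N%:R - N%:R ^+ 4) ->
  ((q * (\sum_(i | i != i0) n i ^ 2) - 2 * N ^ 4) ^ 2 <= 3 * q ^ 4 * N ^ 5)%N.
Proof.
case/andP=> q_gt0 qN Nn s_ge0 sum_s s_le eE s0_eq s_eq.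
set Y := \sum_(i | i != i0) s i ^+ 2.
pose A : K := 3 * q%:R ^+ 2 * N%:R ^+ 3.
have q0 : (0 : K) < q%:R by rewrite ltr0n.
have q_neq0 : (q%:R : K) != 0 by rewrite gt_eqF.
have N0 : (0 : K) < N%:R by rewrite ltr0n (leq_trans q_gt0).
have qNK : (q%:R : K) <= N%:R by rewrite ler_nat.
have NnK : (N%:R : K) <= (n i0)%:R by rewrite ler_nat.
have A0 : 0 <= A by rewrite !mulr_ge0 ?exprn_ge0 ?ltW.
have s0_le : s i0 ^+ 2 <= q%:R ^+ 2 * (n i0)%:R ^+ 2 + N%:R ^+ 4.
  (* If [e = q], then [s i0] is [q * n i0] minus a quantity between 0 and [N ^ 2]; if [e = - q],
     then [N <= n i0] gives [s i0 <= N ^ 2]. *)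
  case: eE s0_eq => ->; rewrite ?mulNr => e0.
    have e1 : s i0 = q%:R * (n i0)%:R - (N%:R ^+ 2 - q%:R * N%:R).
      apply: (mulfI q_neq0).
      by rewrite -[LHS](subrK (q%:R ^+ 2 * N%:R)) e0; ring.
    have D0 : 0 <= N%:R ^+ 2 - q%:R * N%:R :> K by nra.
    have D1 : N%:R ^+ 2 - q%:R * N%:R <= N%:R ^+ 2 :> K by nra.
    move: D0 D1 e1; set D := _ - _ => D0 D1 ->.
    have -> : N%:R ^+ 4 = (N%:R ^+ 2) ^+ 2 :> K by rewrite -exprM.
    move: (N%:R ^+ 2 : K) D1 => M D1.
    have a0 : 0 <= q%:R * (n i0)%:R :> K by rewrite mulr_ge0 ?ler0n.
    rewrite -exprMn; move: (q%:R * _ : K) a0 => a a0; nra.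
  have e1 : s i0 = N%:R ^+ 2 + q%:R * N%:R - q%:R * (n i0)%:R.
    apply: (mulfI q_neq0).
    by rewrite -[LHS](subrK (q%:R ^+ 2 * N%:R)) e0; ring.
  have : s i0 <= N%:R ^+ 2 by rewrite e1; nra.
  have -> : N%:R ^+ 4 = (N%:R ^+ 2) ^+ 2 :> K by rewrite -exprM.
  move: (s_ge0 i0) => s00 s01; apply: ler_wpDl.
    by rewrite mulr_ge0 ?exprn_ge0 ?ler0n.
  by rewrite ler_pXn2r ?nnegrE ?(le_trans s00).
have Y0 : 0 <= Y by apply: sumr_ge0 => i _; exact: exprn_ge0.
have YY : Y ^+ 2 <= A * (q%:R ^+ 2 * N%:R) ^+ 2.
  (* Each [s i * s j] is at most [A], so its square is at most [A * (s i * s j)]; no square root of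
     [A] is taken. *)
  have /le_trans : Y ^+ 2 <= A * (\sum_(i | i != i0) s i) ^+ 2.
    rewrite !expr2 /Y !mulr_suml mulr_sumr; apply: ler_sum => i ii0.
    rewrite !mulr_sumr; apply: ler_sum => j ji0.
    have : s i * s j <= A.
      rewrite -(@ler_pXn2r _ 2) ?nnegrE ?mulr_ge0 // exprMn [leRHS]expr2.
      by apply: ler_pM; rewrite ?exprn_ge0 ?s_le.
    have := mulr_ge0 (s_ge0 i) (s_ge0 j); rewrite -exprMn.
    by move: (s i * s j) => t t0 tA; rewrite expr2; apply: ler_wpM2r.
  apply; rewrite ler_wpM2l // ler_pXn2r ?nnegrE ?sumr_ge0 //.
    by rewrite -sum_s [leRHS](bigD1 i0) //= lerDr.
  by rewrite mulr_ge0 ?exprn_ge0 ?ltW.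
(* One [N ^ 4] comes from the energy identity and one from the imperfect cancellation of
   [s i0 ^+ 2], enlarged to [q * N ^ 4]; hence the 2. *)
have main : q%:R ^+ 2 * (\sum_(i | i != i0) n i ^ 2)%N%:R
            <= Y + 2 * q%:R * N%:R ^+ 4.
  move: s_eq; rewrite (bigD1 i0) //= -/Y [in X in _ = X -> _](bigD1 i0) //=.
  rewrite natrD natrX; move: ((\sum_(i | _) _)%N%:R : K) => B e1.
  have e2 : q%:R ^+ 2 * B
      = Y + s i0 ^+ 2 - q%:R ^+ 2 * (n i0)%:R ^+ 2 + q%:R * N%:R ^+ 4
        - q%:R ^+ 3 * N%:R ^+ 2.
    apply: (mulfI q_neq0).
    have -> : q%:R * (q%:R ^+ 2 * B)
       = q%:R ^+ 2 * (q%:R * ((n i0)%:R ^+ 2 + B) - N%:R ^+ 4)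
         - q%:R ^+ 3 * (n i0)%:R ^+ 2 + q%:R ^+ 2 * N%:R ^+ 4 by ring.
    by rewrite -e1; ring.
  have q1 : (1 : K) <= q%:R by rewrite ler1n.
  have N4 : N%:R ^+ 4 <= q%:R * N%:R ^+ 4 :> K.
    by rewrite ler_peMl // exprn_ge0 // ltW.
  have z0 : 0 <= q%:R ^+ 3 * N%:R ^+ 2 :> K by rewrite mulr_ge0 ?exprn_ge0 ?ltW.
  by rewrite e2 -mulrA; lra.
have [le|/ltnW le] := leqP (q * \sum_(i | i != i0) n i ^ 2) (2 * N ^ 4).
  by move/eqP: le => ->.
have diffE : (q * (\sum_(i | i != i0) n i ^ 2) - 2 * N ^ 4)%N%:R
    = q%:R * (\sum_(i | i != i0) n i ^ 2)%N%:R - 2 * N%:R ^+ 4 :> K.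
  by rewrite natrB // (natrM K q) (natrM K 2) (natrX K N).
have boundE : (3 * q ^ 4 * N ^ 5)%N%:R = 3 * q%:R ^+ 4 * N%:R ^+ 5 :> K.
  by rewrite natrM (natrM _ 3) (natrX _ q) (natrX _ N).
rewrite -(ler_nat K) boundE.
have -> : ((q * (\sum_(i | i != i0) n i ^ 2) - 2 * N ^ 4) ^ 2)%N%:R
    = (q%:R * (\sum_(i | i != i0) n i ^ 2)%N%:R - 2 * N%:R ^+ 4) ^+ 2 :> K.
  by rewrite -diffE (natrX K _ 2).
have q2 : 0 < (q%:R : K) ^+ 2 by rewrite exprn_gt0.
rewrite -(ler_pM2l q2) -exprMn.
have X0 : 0 <= q%:R * (q%:R * (\sum_(i | i != i0) n i ^ 2)%N%:R
                       - 2 * N%:R ^+ 4) :> K.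
  by rewrite -diffE mulr_ge0 ?ler0n.
have : q%:R * (q%:R * (\sum_(i | i != i0) n i ^ 2)%N%:R - 2 * N%:R ^+ 4) <= Y.
  by move: main; rewrite mulrBr !mulrA -expr2 [q%:R * 2]mulrC; lra.
rewrite -(ler_pXn2r (n := 2) _ X0 Y0) // => /le_trans; apply.
apply: le_trans YY _; rewrite le_eqVlt; apply/orP; left; apply/eqP.
by rewrite /A; ring.
Qed.

(** * Random sampling *)

Section Sampling.

Variables (T : finType) (m : nat).
Local Notation M := m.+1.
Implicit Types (A : {set T}) (chi : {ffun T -> 'I_M}).

(* For a uniformly random colouring [chi], [zeros chi] is a random subset that
   contains each point with probability [1 / M]. *)
Definition zeros chi : {set T} := [set x | chi x == ord0].

(** A colouring that vanishes on [A] is an arbitrary colouring of the complement. *)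
Lemma card_vanishing A :
  (#|[set chi | A \subset zeros chi]| * M ^ #|A| = M ^ #|T|)%N.
Proof.
rewrite -(cardsC A) addnC expnD; congr (_ * _)%N.
rewrite -[M in RHS]card_ord -(card_pffun_on ord0 (~: A) predT).
apply: eq_card => chi; rewrite inE.
apply/subsetP/pffun_onP => [sub | [/subsetP supp _] x xA].
  split=> // ; apply/subsetP => x; rewrite !inE.
  by apply: contraNN => /sub; rewrite inE.
rewrite inE; apply: contraTT xA => chix.
by have := supp x; rewrite !inE; apply.
Qed.

(** Linearity of expectation with denominators cleared. *)
Lemma sum_vanishing (S : finType) (H : {set S}) (supp : S -> {set T}) k :
  (forall h, h \in H -> #|supp h| = k) ->
  ((\sum_chi #|[set h in H | supp h \subset zeros chi]|) * M ^ k
   = #|H| * M ^ #|T|)%N.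
Proof.
move=> suppk.
have -> : (\sum_chi #|[set h in H | supp h \subset zeros chi]|
    = \sum_(h in H) #|[set chi | supp h \subset zeros chi]|)%N.
  under eq_bigr do rewrite -sum1dep_card big_mkcondr.
  rewrite exchange_big; apply: eq_bigr => h _ /=.
  by rewrite -big_mkcond /= sum1dep_card.
rewrite big_distrl -sum_nat_const; apply: eq_bigr => h hH /=.
by rewrite -(suppk h hH) card_vanishing.
Qed.

(** Deletion method: a sample has on average [#|E| / M] points, [#|H2| / M ^ 2] bad pairs and
    [#|H4| / M ^ 4] bad quadruples; the bound is multiplied by [M ^ 4]. *)
Lemma exists_sample (E : {set T}) (H2 : {set T * T})
    (H4 : {set (T * T) * (T * T)}) :
  (forall p, p \in H2 -> p.1 != p.2) ->
  (forall h, h \in H4 -> uniq [:: h.1.1; h.1.2; h.2.1; h.2.2]) ->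
  exists U : {set T},
    [/\ U \subset E,
        forall p, p \in H2 -> ~~ ((p.1 \in U) && (p.2 \in U)),
        forall h, h \in H4 ->
          ~~ [&& h.1.1 \in U, h.1.2 \in U, h.2.1 \in U & h.2.2 \in U]
      & (#|E| * M ^ 3 <= #|U| * M ^ 4 + (#|H2| * M ^ 2 + #|H4|))%N].
Proof.
move=> H2P H4P.
pose E1 chi := [set x in E | [set x] \subset zeros chi].
pose bad2 chi := [set p in H2 | [set p.1; p.2] \subset zeros chi].
pose bad4 chi := [set h : (T * T) * (T * T) in H4 |
   [set:: [:: h.1.1; h.1.2; h.2.1; h.2.2]] \subset zeros chi].
have sum1 : ((\sum_chi #|E1 chi|) * M ^ 1 = #|E| * M ^ #|T|)%N.
  by apply: sum_vanishing => x _; rewrite cards1.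
have sum2 : ((\sum_chi #|bad2 chi|) * M ^ 2 = #|H2| * M ^ #|T|)%N.
  by apply: (@sum_vanishing _ H2 (fun p => [set p.1; p.2])) => p /H2P pn;
     rewrite cards2 pn.
have sum4 : ((\sum_chi #|bad4 chi|) * M ^ 4 = #|H4| * M ^ #|T|)%N.
  apply: (@sum_vanishing _ H4
            (fun h => [set:: [:: h.1.1; h.1.2; h.2.1; h.2.2]])).
  move=> h /H4P hu; rewrite cardsE; exact: (card_uniqP hu).
have [chi chiP] : exists chi,
    (#|E| * M ^ 3 + (#|bad2 chi| + #|bad4 chi|) * M ^ 4
     <= #|E1 chi| * M ^ 4 + (#|H2| * M ^ 2 + #|H4|))%N.
  (* If every colouring failed, summing the strict inequalities, recorded by [.+1], would contradict
     the three averages. *)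
  apply/existsP; apply: contraT; rewrite negb_exists => /forallP lt.
  have : (\sum_chi (#|E1 chi| * M ^ 4 + (#|H2| * M ^ 2 + #|H4|)).+1 <=
          \sum_chi (#|E| * M ^ 3 + (#|bad2 chi| + #|bad4 chi|) * M ^ 4))%N.
    by apply: leq_sum => chi _; rewrite ltnNge lt.
  under eq_bigr do rewrite -addn1.
  rewrite !big_split /= -!big_distrl /= big_split /= !sum_nat_const.
  have -> : #|{ffun T -> 'I_M}| = (M ^ #|T|)%N by rewrite card_ffun card_ord.
  have K0 : (0 < M ^ #|T|)%N by rewrite expn_gt0.
  move: K0 sum1 sum2 sum4; move: (M ^ #|T|)%N => K K0.
  move: (\sum_chi #|E1 chi|)%N (\sum_chi #|bad2 chi|)%N.
  move: (\sum_chi #|bad4 chi|)%N.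
  move=> S4 S1 S2 e1 e2 e4.
  have -> : (S1 * M ^ 4 = K * (#|E| * M ^ 3))%N.
    by rewrite -[4%N]/(1 + 3)%N expnD mulnA e1 mulnCA mulnA.
  have -> : ((S2 + S4) * M ^ 4 = K * (#|H2| * M ^ 2) + K * #|H4|)%N.
    rewrite mulnDl e4 -[4%N]/(2 + 2)%N expnD mulnA e2.
    by rewrite [(#|H4| * K)%N]mulnC mulnCA mulnA.
  by rewrite muln1 -!mulnA -[leqRHS]addn0 leq_add2l leqNgt K0.
(* The first point of each bad pair and each bad quadruple is deleted. *)
pose B := [set p.1 | p in bad2 chi] :|: [set h.1.1 | h in bad4 chi].
exists (E1 chi :\: B); split.
- by apply/subsetP => x; rewrite !inE => /andP[_ /andP[]].
- move=> p pH; apply/negP; rewrite !inE !sub1set.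
  case/andP=> /andP[/norP[+ _] /andP[_ p1]] /and3P[_ _ p2].
  case/negP; apply/imsetP; exists p => //.
  by rewrite inE pH /= subUset !sub1set p1.
- have zerosP y : y \in zeros chi -> chi y == ord0 by rewrite inE.
  move=> h hH; apply/negP; rewrite !inE !sub1set.
  case/and4P=> /andP[/norP[_ +] /andP[_ h1]].
  move=> nB /and3P[_ _ h2] /and3P[_ _ h3] /and3P[_ _ h4].
  case/negP: nB; apply/imsetP; exists h => //; rewrite inE hH /=.
  by apply/subsetP => x; rewrite !inE => /or4P[] /eqP->; apply: zerosP.
- have cardB : (#|B| <= #|bad2 chi| + #|bad4 chi|)%N.
    apply: leq_trans (leq_card_setU _ _) _.
    by apply: leq_add; apply: leq_imset_card.
  have : (#|E1 chi| <= #|E1 chi :\: B| + #|B|)%N.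
    rewrite -(cardsID B (E1 chi)) addnC leq_add2l.
    exact/subset_leq_card/subsetIr.
  move=> cardE1.
  have : (#|E1 chi| * M ^ 4
    <= (#|E1 chi :\: B| + (#|bad2 chi| + #|bad4 chi|)) * M ^ 4)%N.
    by rewrite leq_mul2r (leq_trans cardE1) ?orbT // leq_add2l.
  by rewrite mulnDl; move: chiP; lia.
Qed.

End Sampling.

(** * Counting isotropic pairs and equidistant quadruples *)

Section Counting.

Variables (F : finFieldType).
Local Notation V := 'rV[F]_2.

Lemma card_isotropic : (#|[set z : V | dnorm z == 0%R]| <= 2 * #|F|)%N.
Proof.
rewrite -sum1dep_card big_mkcond big_vec2 mulnC -sum_nat_const.
apply: leq_sum => a _; rewrite -big_mkcond sum1dep_card.
set A := [set _ | _]; have [->|[b]] := set_0Vmem A; first by rewrite cards0.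
rewrite inE => /eqP; rewrite /dnorm vec2_0 vec2_1 => ab.
suff /subset_leq_card /leq_trans : A \subset [set b; - b].
  by apply; rewrite cards2; case: (_ != _).
apply/subsetP => c; rewrite !inE /dnorm vec2_0 vec2_1 => /eqP ac.
by rewrite -eqf_sqr; apply/eqP; apply: (addrI (a ^+ 2)); rewrite ac.
Qed.

Variable E : {set V}.

Lemma nu0_le : (nu E 0%R <= 2 * #|F| * #|E|)%N.
Proof.
have : (#|E| * #|[set z : V | dnorm z == 0%R]| <= 2 * #|F| * #|E|)%N.
  by rewrite mulnC leq_mul2r card_isotropic orbT.
apply: leq_trans; rewrite -cardsX.
pose f (p : V * V) := (p.1, p.1 - p.2).
rewrite -[leqLHS](card_imset _ (f := f)); last first.
  by move=> [x y] [x' y'] [-> /addrI /oppr_inj ->].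
apply: subset_leq_card; apply/subsetP => _ /imsetP[[x y] xy ->]; move: xy.
by rewrite !inE /= => /andP[/andP[-> _]].
Qed.

Lemma nu0_ge : (#|E| <= nu E 0%R)%N.
Proof.
rewrite -[leqLHS](card_imset _ (f := fun x : V => (x, x))); last first.
  by move=> x y [].
apply: subset_leq_card; apply/subsetP => _ /imsetP[x xE ->].
by rewrite !inE /= xE subrr dnorm0 eqxx.
Qed.

(** Distance zero is excluded: pairs at distance zero are deleted separately. *)
Definition equidistant_quadruples : {set (V * V) * (V * V)} :=
  [set h in setX (setX E E) (setX E E) |
    [&& uniq [:: h.1.1; h.1.2; h.2.1; h.2.2],
        dnorm (h.1.1 - h.1.2) == dnorm (h.2.1 - h.2.2)
      & dnorm (h.1.1 - h.1.2) != 0]].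

Lemma card_equidistant_quadruples :
  (#|equidistant_quadruples| <= \sum_(r : F | r != 0%R) nu E r ^ 2)%N.
Proof.
rewrite -sum1_card.
rewrite (partition_big (fun h => dnorm (h.1.1 - h.1.2)) (fun r => r != 0)) /=.
  apply: leq_sum => r r0; rewrite expnS expn1 -cardsX sum1dep_card.
  apply: subset_leq_card; apply/subsetP => -[[x y] [z t]].
  rewrite !inE /= => /andP[/andP[/andP[-> ->] /and3P[_ /eqP e _]] /eqP er].
  by rewrite -e er eqxx.
by move=> h; rewrite inE => /andP[_ /and3P[]].
Qed.

(** The values of [sigma] and the Gauss sum are real, so the identities in [algC] descend along the
    injective [algRval] to [algR], an ordered field as [energy_arithmetic] demands. *)
Lemma energy_bound : odd #|F| -> (#|F| <= #|E|)%N ->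
  ((#|F| * #|equidistant_quadruples| - 2 * #|E| ^ 4) ^ 2
   <= 3 * #|F| ^ 4 * #|E| ^ 5)%N.
Proof.
move=> oddF qN; have [psi psiP] := exists_nontrivial_character F.
have F_gt0 : (0 < #|F|)%N by apply/card_gt0P; exists 0.
have sreal (r : F) : sigma psi E r \is Creal by exact/ger0_real/sigma_ge0.
pose s r := in_algR (sreal r).
have [e eP] : exists e : algR, algRval e = gauss psi 1
    /\ (e = #|F|%:R \/ e = - #|F|%:R).
  case: (gauss_eq psiP oddF) => ->; [exists #|F|%:R|exists (- #|F|%:R)].
    by rewrite rmorph_nat; split; [|left].
  by rewrite rmorphN rmorph_nat; split; [|right].
have /leq_trans : ((#|F| * #|equidistant_quadruples| - 2 * #|E| ^ 4) ^ 2
    <= (#|F| * \sum_(r : F | r != 0%R) nu E r ^ 2 - 2 * #|E| ^ 4) ^ 2)%N.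
  rewrite leq_exp2r // leq_sub2r // leq_mul2l.
  by rewrite card_equidistant_quadruples orbT.
apply.
case: eP => eG ePM; have algRI : injective algRval := val_inj.
have natE n : algRval n%:R = n%:R by rewrite rmorph_nat.
have powE n k : algRval (n%:R ^+ k) = n%:R ^+ k by rewrite rmorphXn rmorph_nat.
apply: (@energy_arithmetic algR F 0 s (nu E) _ _ e) => //.
- by rewrite F_gt0.
- exact: nu0_ge.
- by move=> r; apply: (@sigma_ge0 F psi E r).
- apply: algRI; rewrite rmorph_sum rmorphM rmorphXn !rmorph_nat.
  exact: sum_sigma.
- move=> r r0; have := sigma_sqr_le psiP oddF E r0.
  suff -> : 3 * #|F|%:R ^+ 2 * #|E|%:R ^+ 3
      = algRval (3 * #|F|%:R ^+ 2 * #|E|%:R ^+ 3) by [].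
  rewrite -[RHS]/(algRval 3%:R * algRval (#|F|%:R ^+ 2)
                    * algRval (#|E|%:R ^+ 3)).
  by rewrite !powE natE.
- apply: algRI.
  rewrite -[LHS]/(algRval #|F|%:R * sigma psi E 0
                    - algRval (#|F|%:R ^+ 2) * algRval #|E|%:R).
  rewrite -[RHS]/(algRval e * (algRval #|F|%:R * algRval (nu E 0)%:R
                                 - algRval (#|E|%:R ^+ 2))).
  by rewrite !natE !powE eG nu0_eq.
- apply: algRI.
  rewrite -[LHS]/(algRval #|F|%:R * algRval (\sum_r s r ^+ 2)
                    - (algRval (#|F|%:R ^+ 2) * algRval #|E|%:R) ^+ 2).
  rewrite -[RHS]/(algRval (#|F|%:R ^+ 2)
    * (algRval #|F|%:R * algRval (\sum_r nu E r ^ 2)%:R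
         - algRval (#|E|%:R ^+ 4))).
  by rewrite !natE !powE -(energy_eq psiP) // rmorph_sum.
Qed.

End Counting.

(** * Distinct distance subsets and the choice of parameters *)

(** Four points violating the condition give a pair in [H2] if their common distance is zero, and a
    member of [H4] otherwise. The witness for [Q] is [#|H4|]. *)
Lemma exists_distinct_distance_subset (F : finFieldType) (E : {set 'rV[F]_2})
    (m : nat) :
  odd #|F| -> (#|F| <= #|E|)%N ->
  exists (U : {set 'rV[F]_2}) (Q : nat),
    [/\ U \subset E, distinct_distance U,
        (#|E| * m.+1 ^ 3
           <= #|U| * m.+1 ^ 4 + (2 * #|F| * #|E| * m.+1 ^ 2 + Q))%N
      & ((#|F| * Q - 2 * #|E| ^ 4) ^ 2 <= 3 * #|F| ^ 4 * #|E| ^ 5)%N].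
Proof.
move=> oddF qN.
pose H2 := [set p in setX E E | (p.1 != p.2) && (dnorm (p.1 - p.2) == 0)].
pose H4 := equidistant_quadruples E.
have H2P p : p \in H2 -> p.1 != p.2 by rewrite inE => /and3P[].
have H4P h : h \in H4 -> uniq [:: h.1.1; h.1.2; h.2.1; h.2.2].
  by rewrite inE => /and4P[].
have [U [UE U2 U4 cardU]] := exists_sample m E H2P H4P.
exists U, #|H4|; split=> //.
- case=> x [y [z [t [[xU yU zU tU] xyzt e]]]].
  have inE' v : v \in U -> v \in E by apply/subsetP.
  have xy : x != y.
    by move: xyzt; rewrite /= !inE !negb_or => /andP[/andP[]].
  have [d0|d0] := eqVneq (dnorm (x - y)) 0.
    have /U2 : (x, y) \in H2 by rewrite !inE /= !inE' // xy d0 eqxx.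
    by rewrite xU yU.
  have /U4 : ((x, y), (z, t)) \in H4.
    rewrite in_set; apply/and4P.
    by split; rewrite ?in_setX ?inE' //= -e.
  by rewrite /= xU yU zU tU.
- apply: leq_trans cardU _; rewrite leq_add2l leq_add2r leq_mul2r.
  apply/orP; right; apply: leq_trans (nu0_le E).
  apply: subset_leq_card; apply/subsetP => p.
  by rewrite in_set [in X in _ -> X]in_set => /and3P[-> _ ->].
- exact: energy_bound.
Qed.

Lemma subset_of_card (T : finType) (A : {set T}) (k : nat) :
  (k <= #|A|)%N -> exists2 B : {set T}, B \subset A & #|B| = k.
Proof.
move=> kA; exists [set x in take k (enum A)].
  by apply/subsetP => x; rewrite inE => /mem_take; rewrite mem_enum.
rewrite cardsE (card_uniqP _) ?take_uniq ?enum_uniq // size_takel //.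
by rewrite -cardE.
Qed.

Lemma distinct_distanceS (F : finFieldType) (U W : {set 'rV[F]_2}) :
  U \subset W -> distinct_distance W -> distinct_distance U.
Proof.
move=> /subsetP UW Wd [x [y [z [t [[xU yU zU tU] u e]]]]]; apply: Wd.
by exists x, y, z, t; split=> //; split; exact: UW.
Qed.

Lemma distinct_distance1 (F : finFieldType) (x : 'rV[F]_2) :
  distinct_distance [set x].
Proof.
move=> [y [z [t [w [[/set1P -> /set1P -> _ _]]]]]].
by rewrite /= !inE eqxx.
Qed.

(** With [L] the cube root of [q], the lower bound on [N] gives [C ^+ 3 * q ^+ 4 <= N ^+ 3], so the
    error [3 * q ^ 4 * N ^ 5] is [O(N ^ 8)]. *)
Lemma energy_real (R : realFieldType) (C L : R) (q N Q : nat) :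
  0 < C -> 0 < L -> q%:R = L ^+ 3 -> C * L ^+ 4 <= N%:R ->
  ((q * Q - 2 * N ^ 4) ^ 2 <= 3 * q ^ 4 * N ^ 5)%N ->
  q%:R * Q%:R <= (3 / C ^+ 3 + 3) * N%:R ^+ 4 :> R.
Proof.
move=> C0 L0 qE LN QN.
have C3 : 0 < C ^+ 3 by rewrite exprn_gt0.
(* Adding 1 to [3 / C ^+ 3] bounds its square root; a further 2 comes from the subtracted
   [2 * N ^ 4]. *)
pose K := 3 / C ^+ 3 + 1 : R.
have K1 : 3 / C ^+ 3 <= K ^+ 2.
  have : 0 <= 3 / C ^+ 3 by rewrite divr_ge0 // ltW.
  by rewrite /K; move: (3 / C ^+ 3) => a a0; nra.
have K0 : 0 <= K by rewrite addr_ge0 // divr_ge0 // ltW.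
have N3 : C ^+ 3 * q%:R ^+ 4 <= N%:R ^+ 3.
  have -> : C ^+ 3 * q%:R ^+ 4 = (C * L ^+ 4) ^+ 3 by rewrite qE; ring.
  by rewrite ler_pXn2r ?nnegrE ?ler0n // mulr_ge0 ?exprn_ge0 // ltW.
pose D := (q * Q - 2 * N ^ 4)%N.
have D2 : D%:R ^+ 2 <= (K * N%:R ^+ 4) ^+ 2.
  have : (D ^ 2)%N%:R <= (3 * q ^ 4 * N ^ 5)%N%:R :> R by rewrite ler_nat.
  rewrite (natrX R D) (natrM R _ (N ^ 5)) (natrM R 3) (natrX R q) (natrX R N).
  move=> /le_trans; apply.
  have N5 : 0 <= (N%:R : R) ^+ 5 by rewrite exprn_ge0.
  have N8 : 0 <= (N%:R : R) ^+ 8 by rewrite exprn_ge0.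
  have : 3 * q%:R ^+ 4 * N%:R ^+ 5 <= 3 / C ^+ 3 * N%:R ^+ 8 :> R.
    have -> : 3 * q%:R ^+ 4 * N%:R ^+ 5
        = 3 / C ^+ 3 * (C ^+ 3 * q%:R ^+ 4) * N%:R ^+ 5.
      by field; rewrite gt_eqF.
    have -> : 3 / C ^+ 3 * N%:R ^+ 8 = 3 / C ^+ 3 * N%:R ^+ 3 * N%:R ^+ 5.
      by field; rewrite gt_eqF.
    by rewrite ler_wpM2r // ler_wpM2l // divr_ge0 // ltW.
  move=> /le_trans; apply; rewrite exprMn -exprM.
  by rewrite ler_wpM2r.
have DK : D%:R <= K * N%:R ^+ 4.
  by rewrite -(@ler_pXn2r _ 2) ?nnegrE ?ler0n // mulr_ge0 ?exprn_ge0.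
have : (q * Q)%N%:R <= (D + 2 * N ^ 4)%N%:R :> R.
  by rewrite ler_nat addnC -leq_subLR.
rewrite natrM natrD (natrM R 2) (natrX R N) /K in DK *; lra.
Qed.

(** The mean sample size [a = N / M] lies between [d * L / 2] and [d * L]. Smallness of [d] makes
    each of the two losses at most [a / 8], and [3 * a / 4] exceeds [d / 4 * L]. *)
Lemma sample_bound (R : realFieldType) (C K L d N M n Q : R) :
  0 < C -> 0 <= K -> 1 <= L -> 0 < d <= 1 -> 16 * d <= C -> 8 * K * d <= 1 ->
  C * L ^+ 4 <= N -> L ^+ 3 * Q <= K * N ^+ 4 ->
  N / (d * L) <= M <= 2 * (N / (d * L)) ->
  N * M ^+ 3 <= n * M ^+ 4 + (2 * L ^+ 3 * N * M ^+ 2 + Q) ->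
  d / 4 * L <= n.
Proof.
move=> C0 K0 L1 /andP[d0 d1] dC dK LN QN /andP[M1 M2] nM.
have L0 : 0 < L by apply: lt_le_trans L1.
have N0 : 0 < N by apply: lt_le_trans LN; rewrite mulr_gt0 ?exprn_gt0.
have dL0 : 0 < d * L by rewrite mulr_gt0.
have M0 : 0 < M by apply: lt_le_trans M1; rewrite divr_gt0.
pose a := N / M.
have a0 : 0 < a by rewrite divr_gt0.
have aM : N = a * M by rewrite divfK ?gt_eqF.
have a1 : a <= d * L.
  by rewrite ler_pdivrMr // mulrC -ler_pdivrMr.
have a2 : d * L <= 2 * a.
  rewrite /a mulrA ler_pdivlMr // mulrC -ler_pdivlMr //.
  by rewrite -mulrA.
clearbody a.
have n1 : a - 2 * L ^+ 3 * a ^+ 2 / N - Q / M ^+ 4 <= n.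
  rewrite -(ler_pM2r (exprn_gt0 4 M0)).
  have -> : (a - 2 * L ^+ 3 * a ^+ 2 / N - Q / M ^+ 4) * M ^+ 4
     = N * M ^+ 3 - (2 * L ^+ 3 * N * M ^+ 2 + Q).
    by rewrite aM; field; rewrite (gt_eqF a0) (gt_eqF M0).
  by lra.
have b1 : 2 * L ^+ 3 * a ^+ 2 / N <= a / 8.
  rewrite ler_pdivrMr //.
  have e1 : a * (C * L ^+ 4) <= a * N by rewrite ler_pM2l.
  have e2 : 16 * L ^+ 3 * (a * a) <= a * (C * L ^+ 4).
    have -> : a * (C * L ^+ 4) = L ^+ 3 * a * (C * L) by ring.
    have -> : 16 * L ^+ 3 * (a * a) = L ^+ 3 * a * (16 * a) by ring.
    rewrite ler_pM2l ?mulr_gt0 ?exprn_gt0 //.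
    have : 16 * d * L <= C * L by rewrite ler_pM2r.
    by lra.
  by lra.
have b2 : Q / M ^+ 4 <= a / 8.
  rewrite ler_pdivrMr ?exprn_gt0 // -(ler_pM2l (exprn_gt0 3 L0)).
  apply: le_trans QN _; rewrite aM exprMn.
  have -> : L ^+ 3 * (a / 8 * M ^+ 4) = (L ^+ 3 / 8 * a) * M ^+ 4 by ring.
  have -> : K * (a ^+ 4 * M ^+ 4) = K * a ^+ 3 * a * M ^+ 4 by ring.
  rewrite ler_pM2r ?exprn_gt0 // ler_pM2r //.
  have a3 : a ^+ 3 <= d * L ^+ 3.
    have : a ^+ 3 <= (d * L) ^+ 3.
      by rewrite ler_pXn2r ?nnegrE // ltW.
    move=> /le_trans; apply; rewrite exprMn ler_pM2r ?exprn_gt0 //.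
    by rewrite exprS ler_piMr ?(ltW d0) // exprn_ile1 ?(ltW d0).
  have : K * a ^+ 3 <= K * (d * L ^+ 3) by rewrite ler_wpM2l.
  have : 8 * K * d * L ^+ 3 <= 1 * L ^+ 3 by rewrite ler_pM2r ?exprn_gt0.
  by lra.
lra.
Qed.

Theorem theorem1p7 (R : realType) (C : R) (C_gt0 : 0 < C) :
  exists c1 c2 : R,
    [/\ 0 < c1, 0 < c2
      & forall (F : finFieldType) (E : {set 'rV[F]_2}),
          odd #|F| ->
          C * (#|F|%:R `^ (4%:R / 3%:R)) <= #|E|%:R ->
          exists U : {set 'rV[F]_2},
            [/\ U \subset E, distinct_distance U,
                c1 * (#|F|%:R `^ (1 / 3%:R)) <= #|U|%:R
              & #|U|%:R <= c2 * (#|F|%:R `^ (1 / 2%:R))]].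
Proof.
have [K KE] : exists K, K = 3 / C ^+ 3 + 3 by exists (3 / C ^+ 3 + 3).
have C3 : 0 < C ^+ 3 by rewrite exprn_gt0.
have K_gt0 : 0 < K by rewrite KE addr_gt0 // divr_gt0.
have C16 : 0 < 16 / C by rewrite divr_gt0.
have dinv : 0 < 1 + 16 / C + 8 * K by lra.
(* Each of the three upper bounds on [d] is read off from one summand of its inverse. *)
have [d d_gt0 dE] : exists2 d, 0 < d & d * (1 + 16 / C + 8 * K) = 1.
  exists (1 + 16 / C + 8 * K)^-1; first by rewrite invr_gt0.
  by rewrite mulVf ?gt_eqF.
have d_bounds : [/\ d <= 1, 16 * d <= C & 8 * K * d <= 1].
  have x0 : 0 < d * (16 / C) by rewrite mulr_gt0.
  have y0 : 0 < d * K by rewrite mulr_gt0.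
  rewrite !mulrDr mulr1 in dE; split; [lra| |lra].
  have : d * (16 / C) <= 1 by lra.
  by rewrite mulrA ler_pdivrMr // mul1r mulrC.
case: d_bounds => d_le1 d_leC d_leK.
have c1_gt0 : 0 < d / 4 by rewrite divr_gt0.
exists (d / 4), (d / 4 + 1); split=> // [|F E oddF LN].
  by rewrite addr_gt0.
pose q : R := #|F|%:R; pose L : R := q `^ (1 / 3%:R).
have F_gt0 : (0 < #|F|)%N by apply/card_gt0P; exists 0.
have q1 : 1 <= q by rewrite ler1n.
have q0 : 0 <= q by rewrite ler0n.
have L1 : 1 <= L.
  by rewrite -(powRr0 q) ler_powR // divr_ge0 // ler0n.
have L0 : 0 < L by apply: lt_le_trans L1.
have qE : q = L ^+ 3.
  by rewrite -powR_mulrn ?ltW // -powRrM divfK ?pnatr_eq0 // powRr1.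
have L4 : q `^ (4%:R / 3%:R) = L ^+ 4.
  rewrite -powR_mulrn ?ltW // -powRrM; congr (_ `^ _).
  by rewrite mulrAC mul1r.
have L2 : L <= q `^ (1 / 2%:R).
  by rewrite ler_powR // ler_pM2l // lef_pV2 ?posrE ?ltr0n // ler_nat.
rewrite -/q L4 in LN; rewrite -/q -/L.
(* The lower bound suffices: cutting [W] down to at most one point more than the integer part of
   [d / 4 * L] keeps it, and [1 <= L] bounds the size by [(d / 4 + 1) * L]. *)
suff [W [WE Wd cardW]] : exists W : {set 'rV[F]_2},
    [/\ W \subset E, distinct_distance W & d / 4 * L <= #|W|%:R].
  pose k := minn #|W| (Num.truncn (d / 4 * L)).+1.
  have dL0 : 0 <= d / 4 * L by rewrite mulr_ge0 // ltW.
  have [U UW cardU] : exists2 U : {set 'rV[F]_2}, U \subset W & #|U| = k.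
    by apply: subset_of_card; exact: geq_minl.
  exists U; split.
  - exact: subset_trans WE.
  - exact: distinct_distanceS Wd.
  - rewrite cardU /k; case: leqP => // _.
    by rewrite ltW // -truncn_le_nat.
  - have kle : (k <= (Num.truncn (d / 4 * L)).+1)%N by exact: geq_minr.
    have : (k%:R : R) <= (Num.truncn (d / 4 * L)).+1%:R by rewrite ler_nat.
    rewrite cardU => /le_trans; apply.
    have tr : (Num.truncn (d / 4 * L))%:R <= d / 4 * L.
      by rewrite -truncn_ge_nat.
    rewrite -[leLHS]natr1.
    have : (d / 4 + 1) * L <= (d / 4 + 1) * q `^ (1 / 2%:R).
      by rewrite ler_pM2l //; lra.
    by lra.
(* If [#|E| < #|F|], the hypothesis forces [C * L <= 1], so [L] is bounded and a single point is
   enough. *)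
have [qN|Nq] := leqP #|F| #|E|; last first.
  have N0 : 0 < (#|E|%:R : R).
    by apply: lt_le_trans LN; rewrite mulr_gt0 ?exprn_gt0.
  have [x xE] : exists x, x \in E by apply/card_gt0P; rewrite -(ltr0n R).
  exists [set x]; split; first by rewrite sub1set.
    exact: distinct_distance1.
  rewrite cards1.
  have CL : C * L <= 1.
    have : C * L ^+ 4 <= L ^+ 3.
      by apply: le_trans LN _; rewrite -qE ler_nat ltnW.
    have -> : C * L ^+ 4 = (C * L) * L ^+ 3 by ring.
    by rewrite ger_pMl ?exprn_gt0.
  have : 16 * d * L <= C * L by rewrite ler_pM2r.
  have : 0 < d * L by rewrite mulr_gt0.
  by lra.
pose x := #|E|%:R / (d * L).
have dL0 : 0 < d * L by rewrite mulr_gt0.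
have x1 : 1 <= x.
  rewrite ler_pdivlMr // mul1r; apply: le_trans LN.
  have e1 : d * L <= C * L by rewrite ler_pM2r //; lra.
  apply: le_trans e1 _; rewrite ler_pM2l // exprS ler_peMr ?(ltW L0) //.
  by rewrite exprn_ege1.
(* Since [1 <= x], the inverse probability [m.+1] lies between [x] and [2 * x]. *)
pose m := Num.truncn x.
have [U [Q [UE Ud cardU QN]]] := exists_distinct_distance_subset m oddF qN.
exists U; split=> //.
apply: (@sample_bound _ C K L d #|E|%:R m.+1%:R _ Q%:R) => //.
- exact: ltW.
- by rewrite d_gt0.
- by rewrite KE -qE; apply: (energy_real C_gt0 L0).
- have mx : m%:R <= x by rewrite -truncn_ge_nat // (le_trans _ x1).
  have xm : x < m.+1%:R by rewrite -truncn_le_nat.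
  by rewrite -/x ltW //= -[leLHS]natr1; lra.
- rewrite -qE /q; move: cardU.
  move: #|E| #|U| #|F| m.+1 => N n p M; rewrite -(ler_nat R) !natrD.
  rewrite (natrM R N) (natrM R n) (natrM R (2 * p * N)) (natrM R (2 * p)).
  by rewrite (natrM R 2) !natrX.
Qed.
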